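(* A dynamical system $(X,T)$ is a van der Waerden system if and only if it has a dense set of multi-recurrent points.
   Context: A (topological) dynamical system $(X,T)$ consists of a (nonempty) compact metric space and a continuous map $T\colon X\to X$. $\mathbb{N}$ is the set of positive integers. $(X,T)$ is a van der Waerden system if for every non-empty open set $U\subset X$ and every $d\in\mathbb{N}$ there exists $n\in\mathbb{N}$ such that $U\cap T^{-n}U\cap T^{-2n}U\cap\dots\cap T^{-dn}U\ne\emptyset$. A point $x\in X$ is multi-recurrent if for every $d\ge 1$ there exists a strictly increasing sequence $\{n_k\}_{k=1}^\infty$ in $\mathbb{N}$ such that $T^{in_k}x\to x$ as $k\to\infty$ for each $i=1,2,\dots,d$. *)

(* Defs.v *)
From HB Require Import structures.
From mathcomp Require Import all_boot all_order all_algebra.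
From mathcomp Require Import all_classical all_reals all_analysis.

Set Implicit Arguments.
Unset Strict Implicit.
Unset Printing Implicit Defensive.

Local Open Scope classical_set_scope.

Definition dynamical_system (R : realType) (X : metricType R) (T : X -> X) : Prop :=
  [/\ [set: X] !=set0, compact [set: X] & continuous T].

(* The index i = 0 contributes U itself. *)
Definition vdW_system (X : topologicalType) (T : X -> X) : Prop :=
  forall U : set X, open U -> U !=set0 ->
  forall d : nat, (0 < d)%N ->
  exists2 n : nat, (0 < n)%N &
    (\bigcap_(i in [set i : nat | (i <= d)%N]) (iter (i * n)%N T @^-1` U))
      !=set0.

Definition multi_recurrent (X : topologicalType) (T : X -> X) (x : X) : Prop :=
  forall d : nat, (1 <= d)%N ->
  exists n : nat -> nat,
    [/\ forall k, (0 < n k)%N,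
        forall j k, (j < k)%N -> (n j < n k)%N
      & forall i : nat, (1 <= i <= d)%N ->
          (fun k => iter (i * n k)%N T x) @ \oo --> x].

(* Main.v *)
Require Import Defs.
From HB Require Import structures.
From mathcomp Require Import all_boot all_order all_algebra.
From mathcomp Require Import all_classical all_reals all_analysis.

Import Order.TTheory GRing.Theory Num.Theory.

Local Open Scope classical_set_scope.

(** Multi-recurrence implies the van der Waerden property at once: a
    multi-recurrent point [x] of [U] returns to [U] at the times
    [n, 2 n, ..., d n] as soon as [n] is a late enough term of its sequence of
    return times.

    Conversely, approximate multi-recurrence is an open condition, and Baire's
    theorem passes to the limit.  For each [m], consider the points [x] such
    that, for some [n > m], all of [x, T^n x, ..., T^((m+1) n) x] lie in one
    common open ball of radius [1/(m+1)].  These points form an open set, and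
    the van der Waerden property applied inside small open sets makes it dense
    ([return_set_dense]).  A compact metric space is a Baire space
    ([compact_regular_baire]), so the points lying in all these sets are dense,
    and each of them is multi-recurrent ([return_sets_multi_recurrent]): the
    return times produced for [m = 0, 1, 2, ...] can be thinned out to an
    increasing sequence because the one produced for [m] exceeds [m]. *)

Section FilterAndBaire.

Lemma near_forall_leq {I : Type} {F : set_system I} {FF : Filter F} (d : nat)
    (P : nat -> I -> Prop) :
  (forall i, (i <= d)%N -> \forall x \near F, P i x) ->
  \forall x \near F, forall i, (i <= d)%N -> P i x.
Proof.
elim: d => [|d IHd] FP.
  by apply: filterS (FP 0%N isT) => x P0x i; rewrite leqn0 => /eqP ->.
have FPd : \forall x \near F, forall i, (i <= d)%N -> P i x.
  by apply: IHd => i id; apply: FP; exact: leqW.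
apply: filterS2 FPd (FP d.+1 (leqnn _)) => x Px Pdx i.
by rewrite leq_eqVlt => /orP[/eqP ->//|]; exact: Px.
Qed.

(** Regularity leaves room for a smaller open set whose closure still lies in
    the given one; with compactness, this replaces the shrinking closed balls
    of the complete case. *)
Lemma regular_shrink {X : topologicalType} (V : set X) : regular_space X ->
  open V -> V !=set0 ->
  exists W : set X, [/\ open W, W !=set0 & closure W `<=` V].
Proof.
move=> regX oV [x Vx].
have [A nxA clAV] := regX x V (open_nbhs_nbhs (conj oV Vx)).
exists A^°; split; [exact: open_interior | by exists x |].
by apply: subset_trans clAV; apply: closureS; exact: interior_subset.
Qed.

(** Baire's theorem for compact regular spaces: a cluster point of a sequence
    picked in nested open sets [W n] lies in the closure of every [W n]. *)
Theorem compact_regular_baire {X : topologicalType} (F : nat -> set X) :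
  compact [set: X] -> regular_space X ->
  (forall n, open (F n) /\ dense (F n)) -> dense (\bigcap_n F n).
Proof.
move=> cX regX odF V V0 oV.
pose opn := {W : set X | open W /\ W !=set0}.
have step (nW : nat * opn) :
    exists W : opn, closure (sval W) `<=` sval nW.2 `&` F nW.1.
  case: nW => n [W [oW W0]] /=; have [oF dF] := odF n.
  have [W' [oW' W'0 clW']] :=
    regular_shrink _ regX (openI oW oF) (dF W W0 oW).
  by exists (exist _ W' (conj oW' W'0)).
have [f fP] := choice step.
pose fix W n : opn := if n is k.+1 then f (k, W k) else exist _ V (conj oV V0).
have WS n : closure (sval (W n.+1)) `<=` sval (W n) `&` F n := fP (n, W n).
have Wle m n : (m <= n)%N -> sval (W n) `<=` sval (W m).
  elim: n => [|n IHn]; first by rewrite leqn0 => /eqP ->.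
  rewrite leq_eqVlt => /orP[/eqP -> //|/IHn]; apply: subset_trans.
  by move=> x /subset_closure /WS[].
have /choice[x Wx] n : exists x, sval (W n) x by exact: (svalP (W n)).2.
have [p [_ clp]] := cX (x @ \oo) _ filterT.
have pW n : closure (sval (W n)) p.
  move=> B pB; apply: clp => //.
  by exists n => // k /= nk; apply: Wle nk _ (Wx k).
exists p; split; first by have [] := WS 0%N p (pW 1%N).
by move=> n _; have [] := WS n p (pW n.+1).
Qed.

End FilterAndBaire.

Lemma iter_continuous {X : topologicalType} (T : X -> X) (n : nat) :
  continuous T -> continuous (iter n T).
Proof.
move=> cT; elim: n => [|n IHn] x; first exact: cvg_id.
exact: continuous_comp (IHn x) (cT _).
Qed.

Lemma multi_return_open {X : topologicalType} (T : X -> X) (U : set X)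
    (d n : nat) : continuous T -> open U ->
  open (\bigcap_(i in [set i : nat | (i <= d)%N]) (iter (i * n) T @^-1` U)).
Proof.
move=> cT oU; rewrite openE => x Ux; apply: near_forall_leq => i id.
apply: (iter_continuous T (i * n) cT x).
exact: open_nbhs_nbhs (conj oU (Ux i id)).
Qed.

(** A van der Waerden return time can be taken as large as desired: a return
    time [n] for [d * m.+1] steps gives the return time [m.+1 * n] for [d]
    steps. *)
Lemma vdW_large_return {X : topologicalType} (T : X -> X) (U : set X)
    (d m : nat) : vdW_system T -> open U -> U !=set0 -> (0 < d)%N ->
  exists2 n : nat, (m < n)%N &
    (\bigcap_(i in [set i : nat | (i <= d)%N]) (iter (i * n)%N T @^-1` U))
      !=set0.
Proof.
move=> vdW oU U0 d0.
have [|n n0 [x Ux]] := vdW U oU U0 (d * m.+1)%N; first by rewrite muln_gt0 d0.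
exists (m.+1 * n)%N; first exact: leq_pmulr.
by exists x => i /= id; rewrite mulnA; apply: Ux; rewrite /= leq_mul2r.
Qed.

Section Recurrence.
Context {R : realType} {X : pseudoMetricType R}.
Variable T : X -> X.

(** Open balls centred at an arbitrary [z], rather than at the returning
    point, make the openness of this set immediate. *)
Definition return_set (m : nat) : set X :=
  \bigcup_(n in [set n : nat | (m < n)%N]) \bigcup_z
    \bigcap_(i in [set i : nat | (i <= m.+1)%N])
      (iter (i * n) T @^-1` (ball z (m.+1%:R^-1)%R)^°).

Lemma return_set_open (m : nat) : continuous T -> open (return_set m).
Proof.
move=> cT; apply: bigcup_open => n _; apply: bigcup_open => z _.
by apply: multi_return_open => //; exact: open_interior.
Qed.

Lemma return_set_dense (m : nat) : vdW_system T -> dense (return_set m).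
Proof.
move=> vdW V [z Vz] oV.
set B := (ball z (m.+1%:R^-1)%R)^°.
have Bz : B z by apply: nbhsx_ballx; rewrite invr_gt0 ltr0n.
have VB0 : V `&` B !=set0 by exists z.
have [n mn [x VBx]] :=
  vdW_large_return _ _ _ m vdW (openI oV (open_interior _)) VB0 (ltn0Sn m).
exists x; split; first by have [] := VBx 0%N isT.
by exists n => //; exists z => // i im; have [] := VBx i im.
Qed.

Lemma return_set_close (m : nat) (x : X) : return_set m x ->
  exists2 n, (m < n)%N & forall i, (i <= m.+1)%N ->
    ball x (m.+1%:R^-1 + m.+1%:R^-1)%R (iter (i * n) T x).
Proof.
move=> [n mn [z _ Bx]]; exists n => // i im.
apply: (ball_triangle (y := z)).
  by apply: ball_sym; exact: interior_subset (Bx 0%N isT).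
exact: interior_subset (Bx i im).
Qed.

Lemma return_sets_multi_recurrent (x : X) :
  (\bigcap_m return_set m) x -> multi_recurrent T x.
Proof.
move=> Gx d d0.
have /choice[f fP] m : exists n, (m < n)%N /\ forall i, (i <= m.+1)%N ->
    ball x (m.+1%:R^-1 + m.+1%:R^-1)%R (iter (i * n) T x).
  by have [n mn Bn] := return_set_close m x (Gx m I); exists n.
pose n k := iter k.+1 f 0%N.
have nS k : (n k < n k.+1)%N by exact: (fP (n k)).1.
have ltn_n : forall j k, (j < k)%N -> (n j < n k)%N.
  apply: (@homo_ltn _ n (fun a b => (a < b)%N)) nS => a b c.
  exact: ltn_trans.
(* The accuracy of the return time [n k] is governed by the argument
   [iter k f 0] from which it was produced. *)
have le_iter k : (k <= iter k f 0)%N.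
  elim: k => // k IHk; exact: leq_ltn_trans IHk (fP _).1.
exists n; split=> [k||i /andP[_ id]] //.
  exact: leq_ltn_trans (leq0n _) (fP _).1.
apply/cvg_ballP => e e0.
have e20 : (0 < e / 2)%R by rewrite divr_gt0.
near=> k.
have ki : (i <= (iter k f 0%N).+1)%N.
  apply: leqW; apply: leq_trans (le_iter k); apply: leq_trans id _.
  by near: k; exact: nbhs_infty_ge.
apply: le_ball ((fP (iter k f 0%N)).2 i ki).
rewrite [leRHS]splitr.
suff le2 : ((iter k f 0%N).+1%:R^-1 <= e / 2)%R.
  exact: lerD.
apply: (@le_trans _ _ (k.+1%:R^-1)%R).
  by rewrite lef_pV2 ?posrE ?ltr0n//
    ler_nat ltnS le_iter.
apply: ltW.
by near: k; exact: (near_infty_natSinv_lt (PosNum e20)).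
Unshelve. all: by end_near. Qed.

End Recurrence.

Lemma dense_multi_recurrent_vdW {X : topologicalType} (T : X -> X) :
  dense [set x : X | multi_recurrent T x] -> vdW_system T.
Proof.
move=> dT U oU U0 d d0; have [x [Ux mrx]] := dT U U0 oU.
have [n [n0 _ ncvg]] := mrx d d0.
have [N _ UN] : \forall k \near \oo, forall i, (i <= d)%N ->
    U (iter (i * n k) T x).
  apply: near_forall_leq => -[_|i id]; first by near=> k.
  by apply: (ncvg i.+1 id); exact: open_nbhs_nbhs.
exists (n N) => //; exists x => i /= id.
exact: UN (leqnn N) i id.
Unshelve. all: by end_near. Qed.

Theorem lemma4p2 (R : realType) (X : metricType R) (T : X -> X)
    (XT : dynamical_system T) :
  vdW_system T <-> dense [set x : X | multi_recurrent T x].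
Proof.
have [_ cX cT] := XT; split; last exact: dense_multi_recurrent_vdW.
move=> vdW V V0 oV.
have odG m : open (return_set T m) /\ dense (return_set T m).
  by split; [exact: return_set_open | exact: return_set_dense].
have [x [Vx Gx]] :=
  compact_regular_baire (return_set T) cX uniform_regular odG V V0 oV.
by exists x; split=> //; exact: return_sets_multi_recurrent.
Qed.
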